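(* Let $K$ be an algebraically closed field of characteristic zero, let $q\in K\setminus\{0\}$ be a root of unity, and let $m$ be the minimal positive integer with $q^m=1$. Let $\partial_x\in\{D_x,\Delta_x,\Delta_{q,x}\}$ and let $f,g\in K(x,y)$ satisfy $\partial_x(f)=\Delta_{q,y}(g)$. Then there exist rational functions $h\in K(x,y)$ and $a,b\in K(x)(y^m)$ such that $\partial_x(a)=0$ and \[ f=\Delta_{q,y}(h)+a\quad\text{and}\quad g=\partial_x(h)+b. \] Moreover, $a\in K(y^m)$ if $\partial_x\in\{D_x,\Delta_x\}$, and $a\in K(x^m,y^m)$ if $\partial_x=\Delta_{q,x}$.
   Context: $K(x,y)$ is the field of rational functions in $x,y$ over $K$. $D_x=\partial/\partial x$ is the usual derivation. $\sigma_x(f(x,y))=f(x+1,y)$, $\tau_{q,x}(f(x,y))=f(qx,y)$, $\tau_{q,y}(f(x,y))=f(x,qy)$. The difference operators are $\Delta_x(f)=\sigma_x(f)-f$, $\Delta_{q,x}(f)=\tau_{q,x}(f)-f$ and $\Delta_{q,y}(f)=\tau_{q,y}(f)-f$. $K(x)(y^m)$ denotes the subfield of $K(x,y)$ of rational functions in $x$ and $y^m$ (similarly $K(y^m)$, $K(x^m,y^m)$). *)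

(* Defs.v *)
From HB Require Import structures.
From mathcomp Require Import all_boot all_algebra ring.

Set Implicit Arguments.
Unset Strict Implicit.
Unset Printing Implicit Defensive.

Import GRing.Theory.
Local Open Scope ring_scope.
Local Open Scope quotient_scope.

(* K(x,y) is the fraction field of {poly {poly K}}.  As in polyXY, the outer  *)
(* variable 'X is x and the inner variable 'X%:P is y.                        *)
Notation "{ 'ratxy' K }" := {fraction {poly {poly K}}}
  (at level 0, format "{ 'ratxy'  K }") : type_scope.

Section RationalFunctions.
Variable K : fieldType.
Implicit Types (p s : {poly {poly K}}) (f g u v w : {ratxy K}).

Definition rat_const (c : K) : {ratxy K} := FracField.tofrac c%:P%:P.
Definition rat_x : {ratxy K} := FracField.tofrac 'X.
Definition rat_y : {ratxy K} := FracField.tofrac 'X%:P.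

(* A chosen representation f = numer f / denom f, with denom f != 0.  What is *)
(* built on it below does not depend on the choice: see rat_shift_x_frac,     *)
(* rat_qshift_x_frac, rat_qshift_y_frac and rat_deriv_x_frac.                 *)
Definition rat_numer f : {poly {poly K}} := \n_(repr f).
Definition rat_denom f : {poly {poly K}} := \d_(repr f).

(* p(u, v) for a bivariate polynomial p *)
Definition eval_xy p u v : {ratxy K} :=
  (map_poly (map_poly rat_const) p).[u%:P].[v].

(* f(u, v) for a rational function f; only used when x |-> u, y |-> v is      *)
(* injective on polynomials, so that the denominator does not vanish.         *)
Definition rat_subst f u v : {ratxy K} :=
  eval_xy (rat_numer f) u v / eval_xy (rat_denom f) u v.

Definition rat_shift_x f := rat_subst f (rat_x + 1) rat_y.
Definition rat_qshift_x (q : K) f := rat_subst f (rat_const q * rat_x) rat_y.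
Definition rat_qshift_y (q : K) f := rat_subst f rat_x (rat_const q * rat_y).

Definition rat_deriv_x f : {ratxy K} :=
  let p := rat_numer f in let s := rat_denom f in
  FracField.tofrac (p^`() * s - p * s^`()) / FracField.tofrac (s ^+ 2).

Definition rat_delta_x f := rat_shift_x f - f.
Definition rat_qdelta_x (q : K) f := rat_qshift_x q f - f.
Definition rat_qdelta_y (q : K) f := rat_qshift_y q f - f.

(* f belongs to the subfield K(w) of K(x,y) *)
Definition in_subfield1 w f : Prop :=
  exists p s : {poly K}, (map_poly rat_const s).[w] != 0 /\
    f = (map_poly rat_const p).[w] / (map_poly rat_const s).[w].

(* f belongs to the subfield K(u, v) of K(x,y) *)
Definition in_subfield2 u v f : Prop :=
  exists p s, eval_xy s u v != 0 /\ f = eval_xy p u v / eval_xy s u v.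

End RationalFunctions.

Arguments rat_x {K}.
Arguments rat_y {K}.

Inductive x_operator := Op_D | Op_Delta | Op_qDelta.

Definition x_apply (K : fieldType) (q : K) (d : x_operator)
    (f : {ratxy K}) : {ratxy K} :=
  match d with
  | Op_D => rat_deriv_x f
  | Op_Delta => rat_delta_x f
  | Op_qDelta => rat_qdelta_x q f
  end.

Section Representatives.
Variable K : fieldType.
Implicit Types (p s : {poly {poly K}}) (f g u v w : {ratxy K}).

Local Notation "p %:F" := (FracField.tofrac p).

Lemma rat_const_is_zmod_morphism : zmod_morphism (@rat_const K).
Proof. by move=> a b; rewrite /rat_const !rmorphB. Qed.
Lemma rat_const_is_monoid_morphism : monoid_morphism (@rat_const K).
Proof. by split=> [|a b]; rewrite /rat_const ?rmorph1 // !rmorphM. Qed.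
HB.instance Definition _ := GRing.isZmodMorphism.Build K {ratxy K}
  (@rat_const K) rat_const_is_zmod_morphism.
HB.instance Definition _ := GRing.isMonoidMorphism.Build K {ratxy K}
  (@rat_const K) rat_const_is_monoid_morphism.

Lemma rat_denom_neq0 f : rat_denom f != 0.
Proof. exact: denom_ratioP. Qed.

Lemma rat_numden f : f = (rat_numer f)%:F / (rat_denom f)%:F.
Proof.
rewrite /rat_numer /rat_denom; have d0 := denom_ratioP (repr f).
have dF0 : (\d_(repr f))%:F != 0 by rewrite tofrac_eq0.
apply: (mulIf dF0); rewrite divfK // -{1}[f]reprK.
case: (repr f) d0 {dF0} => -[n d] /= d0' d0; unlock FracField.tofrac.
rewrite -[LHS]FracField.pi_mul; apply/eqmodP => /=.
rewrite FracField.equivfE /FracField.mulf.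
by rewrite !numden_Ratio ?mulf_neq0 ?oner_eq0 //= !mulr1 mulrC.
Qed.

Lemma rat_numden_cross p s : s != 0 ->
  let f := p%:F / s%:F in rat_numer f * s = p * rat_denom f.
Proof.
move=> s0 f; apply/eqP; rewrite -tofrac_eq !rmorphM /=.
have F0 r : r != 0 -> r%:F != 0 by rewrite tofrac_eq0.
rewrite -eqr_div ?F0 ?rat_denom_neq0 //.
by rewrite -rat_numden.
Qed.

Lemma eval_xyM u v : {morph (fun p => eval_xy p u v) : p s / p * s}.
Proof. by move=> p s; rewrite /eval_xy rmorphM !hornerM. Qed.

Lemma rat_subst_frac u v p s :
  (forall r : {poly {poly K}}, r != 0 -> eval_xy r u v != 0) -> s != 0 ->
  rat_subst (p%:F / s%:F) u v = eval_xy p u v / eval_xy s u v.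
Proof.
move=> inj s0; apply/eqP; rewrite /rat_subst eqr_div ?inj ?rat_denom_neq0 //.
by rewrite -!eval_xyM rat_numden_cross.
Qed.

Lemma eval_xy_comp (k : K) (l m : K) r :
  eval_xy r (rat_const l * rat_x + rat_const k) (rat_const m * rat_y) =
  (map_poly (fun c : {poly K} => c \Po (m *: 'X)) r
     \Po (l%:P *: 'X + k%:P%:P))%:F.
Proof.
have E1 (c : {poly K}) : (map_poly (@rat_const K) c).[rat_const m * rat_y] =
    ((c \Po (m *: 'X))%:P)%:F.
  elim/poly_ind: c => [|c a IH]; first by rewrite rmorph0 horner0 comp_poly0 !rmorph0.
  rewrite rmorphD rmorphM /= map_polyX map_polyC /= hornerMXaddC IH.
  rewrite comp_polyD comp_polyM comp_polyX comp_polyC !rmorphD !rmorphM /=.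
  by rewrite -mul_polyC !rmorphM.
elim/poly_ind: r => [|r c IH].
  by rewrite /eval_xy !raddf0 !horner0 ?map_poly0 ?raddf0 ?comp_poly0 ?raddf0.
have -> : map_poly (fun c0 : {poly K} => c0 \Po (m *: 'X)) (r * 'X + c%:P) =
   map_poly (fun c0 : {poly K} => c0 \Po (m *: 'X)) r * 'X + (c \Po (m *: 'X))%:P.
  rewrite (@rmorphD _ _ (map_poly (comp_poly (m *: 'X)))).
  by rewrite (@rmorphM _ _ (map_poly (comp_poly (m *: 'X)))) /= map_polyX map_polyC.
rewrite /eval_xy rmorphD rmorphM /= map_polyX map_polyC /=.
rewrite hornerMXaddC hornerD hornerM hornerC -/(eval_xy r _ _) IH E1.
rewrite comp_polyD comp_polyM comp_polyX comp_polyC [in RHS]rmorphD rmorphM /=.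
by rewrite -mul_polyC [in RHS]rmorphD rmorphM.
Qed.

Lemma eval_xy_neq0 (k l m : K) r : l != 0 -> m != 0 -> r != 0 ->
  eval_xy r (rat_const l * rat_x + rat_const k) (rat_const m * rat_y) != 0.
Proof.
move=> l0 m0 r0; rewrite eval_xy_comp tofrac_eq0.
have szX (R : idomainType) (a b : R) : a != 0 -> size (a *: 'X + b%:P) = 2%N.
  by move=> a0; rewrite -mul_polyC size_MXaddC polyC_eq0 (negPf a0) size_polyC a0.
rewrite -size_poly_eq0 size_comp_poly2 ?szX ?polyC_eq0 // size_poly_eq0.
rewrite map_poly_eq0_id0 // -size_poly_eq0 size_comp_poly2 ?size_poly_eq0 ?lead_coef_eq0 //.
by rewrite -[m *: 'X]addr0 -polyC0 szX.
Qed.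

Lemma rat_shift_x_frac p s : s != 0 ->
  rat_shift_x (p%:F / s%:F) =
  eval_xy p (rat_x + 1) rat_y / eval_xy s (rat_x + 1) rat_y.
Proof.
apply: rat_subst_frac => r r0.
have := @eval_xy_neq0 1 1 1 r (oner_neq0 _) (oner_neq0 _) r0.
by rewrite !rmorph1 !mul1r.
Qed.

Lemma rat_qshift_x_frac (q : K) p s : q != 0 -> s != 0 ->
  rat_qshift_x q (p%:F / s%:F) =
  eval_xy p (rat_const q * rat_x) rat_y / eval_xy s (rat_const q * rat_x) rat_y.
Proof.
move=> q0; apply: rat_subst_frac => r r0.
have := @eval_xy_neq0 0 q 1 r q0 (oner_neq0 _) r0.
by rewrite !rmorph0 !rmorph1 !mul1r addr0.
Qed.

Lemma rat_qshift_y_frac (q : K) p s : q != 0 -> s != 0 ->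
  rat_qshift_y q (p%:F / s%:F) =
  eval_xy p rat_x (rat_const q * rat_y) / eval_xy s rat_x (rat_const q * rat_y).
Proof.
move=> q0; apply: rat_subst_frac => r r0.
have := @eval_xy_neq0 0 1 q r (oner_neq0 _) q0 r0.
by rewrite !rmorph0 !rmorph1 !mul1r addr0.
Qed.

Lemma rat_deriv_x_frac p s : s != 0 ->
  rat_deriv_x (p%:F / s%:F) = (p^`() * s - p * s^`())%:F / (s ^+ 2)%:F.
Proof.
move=> s0; have /= := rat_numden_cross p s0; rewrite /rat_deriv_x.
have := rat_denom_neq0 (p%:F / s%:F).
move: (rat_numer _) (rat_denom _) => n d d0 E.
apply/eqP; rewrite eqr_div ?tofrac_eq0 ?expf_neq0 // -!rmorphM tofrac_eq.
have E' : n^`() * s + n * s^`() = p^`() * d + p * d^`() by rewrite -!derivM E.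
have -> : (n^`() * d - n * d^`()) * s ^+ 2 =
   d * s * (n^`() * s + n * s^`()) - d * s^`() * (n * s) - d^`() * s * (n * s).
  by ring.
by rewrite E' E; apply/eqP; ring.
Qed.

End Representatives.

(* Main.v *)
(* Write tau for tau_{q,y}, of order m, and d for the x-operator, an additive
   map commuting with tau.  Put a = (1/m) sum_{j<m} tau^j f, the projection of
   f on the fixed field of tau.  Then f - a = (tau - 1) h for an explicit
   polynomial h in tau applied to f; averaging d f = (tau - 1) g gives d a = 0,
   and b = g - d h is killed by tau - 1.

   A fixed fraction n/d has a fixed denominator after multiplying numerator and
   denominator by the other conjugates of d, and a polynomial fixed by y |-> qy
   is a polynomial in y^m; this identifies the fixed fields.  For D_x and
   Delta_x, if P/Q is a constant and dQ != 0 then P/Q = dP/dQ, which lowers the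
   degree in x of the denominator, until it is free of x. *)

Require Import Defs.
From HB Require Import structures.
From mathcomp Require Import all_boot all_algebra ring.

Set Implicit Arguments.
Unset Strict Implicit.
Unset Printing Implicit Defensive.

Import GRing.Theory.
Local Open Scope ring_scope.

Local Notation "p %:F" := (FracField.tofrac p).

(** * Averaging over a cyclic action, and clearing denominators of fixed fractions *)

(** Telescoping: [t - 1] maps a sum of n consecutive iterates of u to [iter n t u - u]. Everything
    is scaled by m, so a bare additive group suffices; the division by m comes later. *)
Lemma averaging (V : zmodType) (t D : {additive V -> V}) (m : nat) (f g : V) :
  (forall u, D (t u) = t (D u)) -> (forall u, iter m t u = u) ->
  D f = t g - g ->
  exists h a b, [/\ t a = a, t b = b, D a = 0, f *+ m = t h - h + a
    & g *+ m = D h + b].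
Proof.
move=> Dt tm Dfg.
have Dti i u : D (iter i t u) = iter i t (D u).
  by elim: i => //= i IH; rewrite Dt IH.
have tele n u : t (\sum_(i < n) iter i t u) - \sum_(i < n) iter i t u
    = iter n t u - u.
  elim: n => [|n IH]; first by rewrite !big_ord0 raddf0 !subrr.
  rewrite !big_ord_recr /= raddfD opprD addrACA IH.
  by rewrite addrC addrA subrK.
pose a := \sum_(i < m) iter i t f.
(* [t - 1] turns the j-th inner sum into [iter j t f - f]; with the sign, the total over j is
   [f *+ m - a]. *)
pose h := - \sum_(j < m) \sum_(i < j) iter i t f.
have ta : t a = a.
  by apply/eqP; rewrite -subr_eq0 tele tm subrr.
have itB i u v : iter i t (u - v) = iter i t u - iter i t v.
  by elim: i => //= i ->; rewrite raddfB.
have Da : D a = 0.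
  rewrite raddf_sum (eq_bigr (fun i : 'I_m => t (iter i t g) - iter i t g)).
    by rewrite sumrB -raddf_sum tele tm subrr.
  by move=> i _; rewrite Dti Dfg itB -iterSr.
have fE : f *+ m = t h - h + a.
  have -> : t h - h = f *+ m - a; last by rewrite subrK.
  rewrite raddfN -opprD raddf_sum -sumrB.
  under eq_bigr => j _ do rewrite tele.
  by rewrite sumrB opprB sumr_const card_ord.
exists h, a, (g *+ m - D h); split=> //; last by rewrite addrC subrK.
(* Applying [D] to the formula for [f *+ m] kills [a]; commuting [D] with [t] then gives
   [t b = b]. *)
have E : D (t h) - D h = t g *+ m - g *+ m.
  by rewrite -mulrnBl -Dfg -raddfMn fE raddfD Da addr0 raddfB.
by rewrite raddfB raddfMn -Dt -[t g *+ m](subrK (g *+ m)) -E -addrA addrACA addrC addrA subrK addrC.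
Qed.

(** With c the product of the other conjugates of d, [d * c] is the norm of d, and [n * c] is the
    fixed fraction n/d times that norm. The last clause lets a second cofactor be introduced without
    losing invariance under a first, commuting map. *)
Lemma fixed_cofactor (R : idomainType) (t : {rmorphism R -> R}) (m : nat)
    (n d : R) : (0 < m)%N -> (forall u, iter m t u = u) -> d != 0 ->
  t n * d = n * t d ->
  exists c, [/\ c != 0, t (n * c) = n * c, t (d * c) = d * c
   & forall s : {rmorphism R -> R}, (forall u, s (t u) = t (s u)) ->
       s d = d -> s c = c].
Proof.
case: m => // m _ tm d0 tnd.
pose c := \prod_(i < m) iter i.+1 t d.
have it0 i (u : R) : u != 0 -> iter i t u != 0.
  (* [t] is injective because one of its iterates is the identity. *)
  have t0 v : v != 0 -> t v != 0.
    apply: contraNneq => tv0; rewrite -(tm v) iterSr tv0.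
    by elim: (m) => //= k /eqP ->; rewrite rmorph0.
  by move=> u0; elim: i => //= i; apply: t0.
have tdc : t (d * c) = d * c.
  have -> : d * c = \prod_(i < m.+1) iter i t d by rewrite big_ord_recl.
  by rewrite rmorph_prod big_ord_recr [RHS]big_ord_recl /= -iterS tm mulrC.
exists c; split=> // [|| s st sd].
- by apply/prodf_neq0 => i _; apply: it0.
- apply: (mulIf d0); rewrite rmorphM mulrAC tnd.
  by rewrite -!mulrA [c * d]mulrC -tdc rmorphM.
- rewrite rmorph_prod; apply: eq_bigr => i _.
  by elim: (i.+1) => //= j IH; rewrite st IH.
Qed.

(** * Polynomials invariant under scaling of the variable *)

(** For m > 0 this undoes the substitution of ['X^m] for ['X]. The bound [size p] is generous: the
    extra coefficients are zero. *)
Definition contract (R : idomainType) (m : nat) (p : {poly R}) : {poly R} :=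
  \poly_(i < size p) p`_(i * m).

Lemma contractK (R : idomainType) (m : nat) (p : {poly R}) : (0 < m)%N ->
  (forall i, ~~ (m %| i)%N -> p`_i = 0) -> contract m p \Po 'X^m = p.
Proof.
move=> m0 pm; apply/polyP=> i; rewrite coef_comp_poly_Xn //.
case: ifPn => [/dvdnP[j ->]|/pm ->//].
rewrite mulnK // coef_poly; case: ltnP => // sj.
by rewrite nth_default // (leq_trans sj) // leq_pmulr.
Qed.

Lemma coef_comp_scaleX (R : comNzRingType) (q : R) (p : {poly R}) i :
  (p \Po (q *: 'X))`_i = p`_i * q ^+ i.
Proof.
rewrite comp_polyE; under eq_bigr => j _ do rewrite exprZn scalerA.
by rewrite -(poly_def _ (fun j => p`_j * q ^+ j)) coef_poly; case: ltnP => // si; rewrite nth_default ?mul0r.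
Qed.

(** Comparing coefficients, [p]_i * q ^+ i = p[_i], so a nonzero coefficient forces [q ^+ i = 1]. A
    general domain is taken because the result serves both over K, for y, and over K[y], for x. *)
Lemma comp_scaleX_fix (R : idomainType) (m : nat) (q : R) (p : {poly R}) :
  (0 < m)%N -> (forall i, q ^+ i = 1 -> (m %| i)%N) -> p \Po (q *: 'X) = p ->
  contract m p \Po 'X^m = p.
Proof.
move=> m0 qm pq; apply: contractK => // i; apply: contraNeq => pi0.
by apply/qm/(mulfI pi0); rewrite mulr1 -coef_comp_scaleX pq.
Qed.

Lemma iter_comp_scaleX (R : comNzRingType) (m : nat) (q : R) (p : {poly R}) :
  q ^+ m = 1 -> iter m (comp_poly (q *: 'X)) p = p.
Proof.
move=> qm; apply/polyP=> i.
have -> k : (iter k (comp_poly (q *: 'X)) p)`_i = p`_i * q ^+ (i * k).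
  elim: k => [|k IH]; first by rewrite muln0 mulr1.
  by rewrite iterS coef_comp_scaleX IH -mulrA -exprD mulnS addnC.
by rewrite mulnC exprM qm expr1n mulr1.
Qed.

(** * Descent on the denominator for constants of an operator lowering the degree *)

(** Induction on the size of s. If [D s = 0], then [D p = 0] and both are constant polynomials.
    Otherwise p/s = Dp/Ds has a smaller denominator, and the third hypothesis makes the new pair
    satisfy the same proportion. *)
Lemma constant_descent (R : idomainType) (D : {additive {poly R} -> {poly R}}) :
  (forall s, s != 0 -> (size (D s) < size s)%N) ->
  (forall s, D s = 0 -> (size s <= 1)%N) ->
  (forall p s, s != 0 -> D p * s = p * D s -> D (D p) * s = p * D (D s)) ->
  forall p s, s != 0 -> D p * s = p * D s ->
  exists c e, e != 0 /\ p * e%:P = c%:P * s.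
Proof.
move=> szD kerD DD p s; have [n] := ubnP (size s).
elim: n p s => // n IH p s sn s0 Ds.
have [Ds0 | Ds0] := eqVneq (D s) 0.
  have Dp0 : D p = 0 by apply: (mulIf s0); rewrite Ds Ds0 mulr0 mul0r.
  have sE := size1_polyC (kerD _ Ds0); have pE := size1_polyC (kerD _ Dp0).
  exists p`_0, s`_0; rewrite -sE -pE; split=> //.
  by apply: contraNneq s0 => s00; rewrite sE s00.
have [||c [e [e0 E]]] := IH (D p) (D s) _ Ds0.
- exact: leq_trans (szD _ s0) sn.
(* After multiplication by s, both sides of the proportion for [D p] and [D s] become
   [p * D s * D (D s)]. *)
- apply: (mulIf s0); rewrite mulrAC (DD _ _ s0 Ds).
  by rewrite mulrAC -Ds mulrAC.
exists c, e; split=> //; apply: (mulIf Ds0).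
by rewrite mulrAC -Ds mulrAC E mulrAC.
Qed.

Lemma deriv_eq0_size (R : idomainType) (p : {poly R}) :
  [pchar R] =i pred0 -> p^`() = 0 -> (size p <= 1)%N.
Proof.
move=> /pcharf0P char0 dp; apply/leq_sizeP => -[|i] // _.
have := congr1 (fun r : {poly R} => r`_i) dp.
by rewrite coef_deriv coef0 -mulr_natr => /eqP; rewrite mulf_eq0 char0 orbF => /eqP.
Qed.

(** By periodicity p takes the value [p.[0]] at every natural number, and these are pairwise
    distinct in characteristic zero; so [p - p.[0]] has too many roots to be nonzero. *)
Lemma comp_shift_eq_size (R : idomainType) (p : {poly R}) :
  [pchar R] =i pred0 -> p \Po ('X + 1) = p -> (size p <= 1)%N.
Proof.
move=> /pcharf0P char0 shp.
suff: p - (p.[0])%:P == 0 by rewrite subr_eq0 => /eqP->; apply: size_polyC_leq1.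
have ph (i : nat) : p.[i%:R] = p.[0].
  elim: i => // i <-; rewrite -{1}[p in RHS]shp horner_comp.
  by rewrite hornerD hornerX hornerC -natr1.
apply/negPn/negP => r0.
pose rs := [seq i%:R | i <- iota 0 (size (p - (p.[0])%:P))] : seq R.
suff: (size rs < size (p - (p.[0])%:P)%R)%N by rewrite size_map size_iota ltnn.
apply: max_poly_roots => //.
  by apply/allP => _ /mapP[i _ ->]; rewrite /root hornerD hornerN hornerC ph subrr.
rewrite map_inj_uniq ?iota_uniq // => i j.
wlog ij : i j / (i <= j)%N => [H|/esym/eqP].
  by have [/H//|/ltnW/H h /esym/h] := leqP i j.
rewrite -subr_eq0 -natrB // char0 subn_eq0 => ji.
by apply/eqP; rewrite eqn_leq ij.
Qed.

(** The shift preserves size and leading coefficient, so the top terms cancel in the difference. *)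
Lemma size_comp_shiftB (R : idomainType) (p : {poly R}) : p != 0 ->
  (size (p \Po ('X + 1) - p)%R < size p)%N.
Proof.
move=> p0.
have szX : size ('X + 1 : {poly R}) = 2%N by rewrite size_XaddC.
have lcX : lead_coef ('X + 1 : {poly R}) = 1 by rewrite lead_coefXaddC.
have sz := size_comp_poly2 p szX.
rewrite -(prednK (_ : 0 < size p)%N) ?size_poly_gt0 // ltnS; apply/leq_sizeP => j.
rewrite leq_eqVlt coefB => /predU1P[<-|].
  rewrite -{1}sz -[X in X - _]lead_coefE lead_coef_comp ?szX //.
  by rewrite lcX expr1n mulr1 subrr.
by rewrite prednK ?size_poly_gt0 // => pj; rewrite !nth_default ?sz ?subrr.
Qed.

(** * Substitutions in bivariate polynomials *)

Section Substitution.
Variable K : fieldType.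
Implicit Types (u p s : {poly {poly K}}) (v : {poly K}).

(** Polynomial counterpart of [eval_xy]. The inner variable is replaced first, so [u] itself is not
    touched by [v]; being a composite of ring morphisms, it inherits their structure. *)
Definition subst_xy u v : {poly {poly K}} -> {poly {poly K}} :=
  comp_poly u \o map_poly (comp_poly v).
HB.instance Definition _ u v := GRing.RMorphism.on (subst_xy u v).

Lemma subst_xyB u v : {morph subst_xy u v : p s / p - s}.
Proof. exact: rmorphB. Qed.

Lemma subst_xyM u v : {morph subst_xy u v : p s / p * s}.
Proof. exact: rmorphM. Qed.

Lemma eval_y_tofrac v c :
  (map_poly (@rat_const K) c).[v%:P%:F] = (c \Po v)%:P%:F.
Proof.
elim/poly_ind: c => [|c a IH]; first by rewrite rmorph0 horner0 comp_poly0 !rmorph0.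
rewrite rmorphD rmorphM /= map_polyX map_polyC /= hornerMXaddC IH.
by rewrite comp_poly_MXaddC !rmorphD !rmorphM.
Qed.

Lemma eval_xy_tofrac u v p : eval_xy p u%:F v%:P%:F = (subst_xy u v p)%:F.
Proof.
elim/poly_ind: p => [|p c IH].
  by rewrite /eval_xy !rmorph0 !horner0.
have -> : subst_xy u v (p * 'X + c%:P) = subst_xy u v p * u + (c \Po v)%:P.
  rewrite rmorphD rmorphM /= /subst_xy /= map_polyX map_polyC.
  by rewrite comp_polyX comp_polyC.
rewrite /eval_xy rmorphD rmorphM /= map_polyX map_polyC /=.
rewrite hornerMXaddC hornerD hornerM hornerC -/(eval_xy _ _ _) IH eval_y_tofrac.
by rewrite rmorphD rmorphM.
Qed.

Lemma subst_xX v p : subst_xy 'X v p = map_poly (comp_poly v) p.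
Proof. by rewrite /subst_xy /= comp_polyXr. Qed.

Lemma subst_Xy u p : subst_xy u 'X p = p \Po u.
Proof. by rewrite /subst_xy /= map_poly_id // => c _; rewrite comp_polyXr. Qed.

Lemma subst_xyC v c : subst_xy 'X v c%:P = (c \Po v)%:P.
Proof. by rewrite subst_xX map_polyC. Qed.

Lemma subst_xy_comm u v p : map_poly (comp_poly v) u = u ->
  subst_xy u 'X (subst_xy 'X v p) = subst_xy 'X v (subst_xy u 'X p).
Proof. by move=> uv; rewrite !subst_Xy !subst_xX map_comp_poly uv. Qed.

End Substitution.

(** * From polynomial maps to maps of rational functions *)

Lemma rat_frac (K : fieldType) (f : {ratxy K}) :
  exists2 s, s != 0 & exists p : {poly {poly K}}, f = p%:F / s%:F.
Proof.
by exists (rat_denom f); [apply: rat_denom_neq0 | exists (rat_numer f); apply: rat_numden].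
Qed.

Lemma subf_div (F : fieldType) (x y z w : F) : y != 0 -> w != 0 ->
  x / y - z / w = (x * w - z * y) / (y * w).
Proof. by move=> y0 w0; rewrite -mulNr addf_div // mulNr. Qed.

Lemma tofrac_subf_div (K : fieldType) (p s n r : {poly {poly K}}) :
  s != 0 -> r != 0 ->
  p%:F / s%:F - n%:F / r%:F = (p * r - n * s)%:F / (s * r)%:F :> {ratxy K}.
Proof. by move=> s0 r0; rewrite subf_div ?tofrac_eq0 // rmorphB !rmorphM. Qed.

Section FractionExtension.
Variables (K : fieldType) (T : {ratxy K} -> {ratxy K}).
Variable t : {rmorphism {poly {poly K}} -> {poly {poly K}}}.
Hypothesis t_neq0 : forall s, s != 0 -> t s != 0.
Hypothesis T_frac : forall p s, s != 0 -> T (p%:F / s%:F) = (t p)%:F / (t s)%:F.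

(** [T] is known only through its values on fractions; over a common denominator the claim reduces
    to [t] being a ring morphism. *)
Lemma extension_zmod_morphism : zmod_morphism T.
Proof.
move=> f g; have [s s0 [p ->]] := rat_frac f; have [r r0 [n ->]] := rat_frac g.
rewrite tofrac_subf_div // !T_frac ?mulf_neq0 // tofrac_subf_div ?t_neq0 //.
by rewrite rmorphB !rmorphM.
Qed.

Lemma extension_iter m : (forall p, iter m t p = p) -> forall f, iter m T f = f.
Proof.
move=> tm f; have [s s0 [p ->]] := rat_frac f.
have -> : iter m T (p%:F / s%:F) = (iter m t p)%:F / (iter m t s)%:F; last by rewrite !tm.
have it0 i : iter i t s != 0 by elim: i => //= i; apply: t_neq0.
by elim: m {tm} => //= i ->; rewrite T_frac.
Qed.

Lemma extension_fix p s : s != 0 -> T (p%:F / s%:F) = p%:F / s%:F ->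
  t p * s = p * t s.
Proof.
move=> s0; rewrite T_frac // => /eqP.
by rewrite eqr_div ?tofrac_eq0 ?t_neq0 // -!rmorphM tofrac_eq => /eqP.
Qed.

End FractionExtension.

Lemma extension_comm (K : fieldType) (T S : {ratxy K} -> {ratxy K})
    (t s : {poly {poly K}} -> {poly {poly K}}) :
  (forall r, r != 0 -> t r != 0) -> (forall r, r != 0 -> s r != 0) ->
  (forall p r, r != 0 -> T (p%:F / r%:F) = (t p)%:F / (t r)%:F) ->
  (forall p r, r != 0 -> S (p%:F / r%:F) = (s p)%:F / (s r)%:F) ->
  (forall p, s (t p) = t (s p)) -> forall f, S (T f) = T (S f).
Proof.
move=> t0 s0 TE SE st f; have [r r0 [p ->]] := rat_frac f.
by rewrite !(TE, SE) ?t0 ?s0 // !st.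
Qed.

Lemma rat_deriv_x_zmod_morphism (K : fieldType) : zmod_morphism (@rat_deriv_x K).
Proof.
move=> f g; have [s s0 [p ->]] := rat_frac f; have [r r0 [n ->]] := rat_frac g.
rewrite tofrac_subf_div // !rat_deriv_x_frac ?mulf_neq0 //.
rewrite tofrac_subf_div ?expf_neq0 // -exprMn; congr (_%:F / _).
by rewrite derivB !derivM; ring.
Qed.

(** A substitution in y acts on the coefficients of a polynomial in x, and so commutes with the
    formal derivative in x. *)
Lemma rat_deriv_x_comm (K : fieldType) (T : {ratxy K} -> {ratxy K})
    (v : {poly K}) :
  (forall r, r != 0 -> subst_xy 'X v r != 0) ->
  (forall p r, r != 0 ->
     T (p%:F / r%:F) = (subst_xy 'X v p)%:F / (subst_xy 'X v r)%:F) ->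
  forall f, rat_deriv_x (T f) = T (rat_deriv_x f).
Proof.
move=> v0 TE f; have [r r0 [p ->]] := rat_frac f.
rewrite !(TE, rat_deriv_x_frac) ?v0 ?expf_neq0 //.
congr (_%:F / _%:F); last by rewrite [RHS]rmorphXn.
by rewrite subst_xyB !subst_xyM !subst_xX !deriv_map.
Qed.

(** * The q-shifts, their fixed fields and the decomposition *)

Section QShift.
Variables (K : fieldType) (q : K) (m : nat).
Hypothesis q_order : m.-primitive_root q.
Implicit Types (p s : {poly {poly K}}) (f : {ratxy K}).

Local Notation ty := (subst_xy 'X (q *: 'X)).
Local Notation tx := (subst_xy (q%:P *: 'X) 'X).

Let m_gt0 : (0 < m)%N. Proof. exact: prim_order_gt0 q_order. Qed.

Let q_neq0 : q != 0.
Proof.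
apply/eqP => q0; have /eqP := prim_expr_order q_order.
by rewrite q0 expr0n gtn_eqF // eq_sym oner_eq0.
Qed.

Let q_dvd i : q ^+ i = 1 -> (m %| i)%N.
Proof. by rewrite (prim_order_dvd q_order) => ->. Qed.

Let qC_dvd i : q%:P ^+ i = 1 :> {poly K} -> (m %| i)%N.
Proof. by rewrite -rmorphXn => /polyC_inj/q_dvd. Qed.

Lemma const_mul_y : rat_const q * rat_y = (q *: 'X)%:P%:F.
Proof. by rewrite -mul_polyC !rmorphM. Qed.

Lemma const_mul_x : rat_const q * rat_x = (q%:P *: 'X)%:F.
Proof. by rewrite -mul_polyC rmorphM. Qed.

Lemma ty_neq0 s : s != 0 -> ty s != 0.
Proof.
move=> s0; have := @eval_xy_neq0 K 0 1 q s (oner_neq0 _) q_neq0 s0.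
by rewrite !rmorph0 !rmorph1 !mul1r addr0 const_mul_y eval_xy_tofrac tofrac_eq0.
Qed.

Lemma tx_neq0 s : s != 0 -> tx s != 0.
Proof.
move=> s0; have := @eval_xy_neq0 K 0 q 1 s q_neq0 (oner_neq0 _) s0.
rewrite !rmorph0 !rmorph1 !mul1r addr0 const_mul_x.
by rewrite (eval_xy_tofrac _ 'X) tofrac_eq0.
Qed.

Lemma rat_qshift_y_tofrac p s : s != 0 ->
  rat_qshift_y q (p%:F / s%:F) = (ty p)%:F / (ty s)%:F.
Proof. by move=> s0; rewrite rat_qshift_y_frac // const_mul_y !eval_xy_tofrac. Qed.

Lemma rat_qshift_x_tofrac p s : s != 0 ->
  rat_qshift_x q (p%:F / s%:F) = (tx p)%:F / (tx s)%:F.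
Proof.
by move=> s0; rewrite rat_qshift_x_frac // const_mul_x !(eval_xy_tofrac _ 'X).
Qed.

Lemma iter_ty p : iter m ty p = p.
Proof.
have coefi k i : (iter k ty p)`_i = iter k (comp_poly (q *: 'X)) p`_i.
  by elim: k => //= k <-; rewrite subst_xX coef_map.
by apply/polyP=> i; rewrite coefi iter_comp_scaleX // prim_expr_order.
Qed.

Lemma iter_tx p : iter m tx p = p.
Proof.
have -> : iter m tx p = iter m (comp_poly (q%:P *: 'X)) p.
  by apply: eq_iter => r; rewrite subst_Xy.
by rewrite iter_comp_scaleX // -rmorphXn prim_expr_order.
Qed.

Lemma ty_tx p : tx (ty p) = ty (tx p).
Proof.
apply: subst_xy_comm.
by rewrite -[q%:P *: 'X]mul_polyC rmorphM /= map_polyC map_polyX /= comp_polyC.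
Qed.

(** The map acts on each coefficient in K[y] separately, and each fixed coefficient is a polynomial
    in y^m. *)
Lemma ty_fix p : ty p = p ->
  map_poly (comp_poly 'X^m) (map_poly (contract m) p) = p.
Proof.
rewrite subst_xX => pq; apply/polyP=> i; rewrite coef_map coef_map_id0 /=.
  apply: comp_scaleX_fix q_dvd _ => //.
  by rewrite -[in RHS]pq coef_map.
(* Side condition for mapping [contract m] over coefficients: it sends 0 to 0. *)
by rewrite /contract size_poly0 poly_def big_ord0.
Qed.

Lemma rat_y_expm : rat_y ^+ m = ('X^m)%:P%:F :> {ratxy K}.
Proof. by rewrite !rmorphXn. Qed.

Lemma rat_x_expm : rat_x ^+ m = ('X^m)%:F :> {ratxy K}.
Proof. by rewrite rmorphXn. Qed.

Lemma in_subfield_tofrac (u : {poly {poly K}}) (v : {poly K}) p s :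
  s != 0 -> (exists p', subst_xy u v p' = p) -> (exists s', subst_xy u v s' = s) ->
  in_subfield2 u%:F v%:P%:F (p%:F / s%:F).
Proof.
move=> s0 [p' p'E] [s' s'E]; exists p', s'.
by rewrite !eval_xy_tofrac p'E s'E tofrac_eq0.
Qed.

Lemma frac_mul_cofactor p s c : c != 0 ->
  p%:F / s%:F = (p * c)%:F / (s * c)%:F :> {ratxy K}.
Proof.
by move=> c0; rewrite !rmorphM -mulf_div divff ?mulr1 // tofrac_eq0.
Qed.

Lemma qshift_y_fix f : rat_qshift_y q f = f ->
  in_subfield2 rat_x (rat_y ^+ m) f.
Proof.
have [s s0 [p ->]] := rat_frac f.
move=> /(extension_fix ty_neq0 rat_qshift_y_tofrac s0) ps.
have [c [c0 pc sc _]] := fixed_cofactor m_gt0 iter_ty s0 ps.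
rewrite (frac_mul_cofactor _ _ c0) rat_y_expm.
by apply: in_subfield_tofrac; rewrite ?mulf_neq0 //;
  [exists (map_poly (contract m) (p * c)) | exists (map_poly (contract m) (s * c))];
  rewrite subst_xX ty_fix.
Qed.

(** The cofactor argument is rerun in K[y], so that x does not enter the representation in y^m. *)
Lemma qshift_y_fix_y (c e : {poly K}) : e != 0 ->
  rat_qshift_y q (c%:P%:F / e%:P%:F) = c%:P%:F / e%:P%:F ->
  in_subfield1 (rat_y ^+ m) (c%:P%:F / e%:P%:F).
Proof.
move=> e0; have eP0 : e%:P != 0 :> {poly {poly K}} by rewrite polyC_eq0.
move=> /(extension_fix ty_neq0 rat_qshift_y_tofrac eP0) E.
have ce : (c \Po (q *: 'X)) * e = c * (e \Po (q *: 'X)).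
  by apply/polyC_inj; rewrite !polyCM -!subst_xyC; apply: E.
have iterq (r : {poly K}) : iter m (comp_poly (q *: 'X)) r = r.
  by rewrite iter_comp_scaleX // prim_expr_order.
have [k [k0 ck ek _]] := fixed_cofactor m_gt0 iterq e0 ce.
have -> : c%:P%:F / e%:P%:F = (c * k)%:P%:F / (e * k)%:P%:F :> {ratxy K}.
  by rewrite !(polyCM _ k) -frac_mul_cofactor ?polyC_eq0.
exists (contract m (c * k)), (contract m (e * k)).
rewrite rat_y_expm !eval_y_tofrac !(comp_scaleX_fix m_gt0 q_dvd) //.
by rewrite tofrac_eq0 polyC_eq0 mulf_neq0.
Qed.

Lemma qshift_xy_fix f : rat_qshift_x q f = f -> rat_qshift_y q f = f ->
  in_subfield2 (rat_x ^+ m) (rat_y ^+ m) f.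
Proof.
have [s s0 [p ->]] := rat_frac f => fx.
move=> /(extension_fix ty_neq0 rat_qshift_y_tofrac s0) ps.
have [c [c0 pc sc _]] := fixed_cofactor m_gt0 iter_ty s0 ps.
move: fx; rewrite (frac_mul_cofactor _ _ c0).
have sc0 : s * c != 0 by rewrite mulf_neq0.
(* From here p/s denotes the cleared fraction, with numerator and denominator both fixed by [ty]. *)
move: (p * c) (s * c) sc0 pc sc => {s0 ps c0} {}p {}s s0 pE sE.
move=> /(extension_fix tx_neq0 rat_qshift_x_tofrac s0) ps.
(* The second cofactor comes from the conjugates in x; since [s] is fixed by [ty], so is [d], and
   invariance in y survives. *)
have [d [d0 pd sd /(_ _ (fun r => esym (ty_tx r)) sE) dE]] :=
  fixed_cofactor m_gt0 iter_tx s0 ps.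
rewrite (frac_mul_cofactor _ _ d0) rat_y_expm rat_x_expm.
have fixed r : ty r = r -> tx r = r -> exists r', subst_xy 'X^m 'X^m r' = r.
  move=> ry rx; pose r0 := contract m r.
  have r0E : r0 \Po 'X^m = r.
    by apply: comp_scaleX_fix qC_dvd _ => //; rewrite -[RHS]rx subst_Xy.
  exists (map_poly (contract m) r0).
  (* What remains is that [r0] is fixed by [ty]: its coefficients are zero or coefficients of
     [r]. *)
  rewrite /subst_xy /= ty_fix // subst_xX; apply/polyP => i.
  rewrite coef_map coef_poly; case: ifP => _; last exact: comp_poly0.
  by rewrite -[in RHS]ry subst_xX coef_map.
by apply: in_subfield_tofrac; rewrite ?mulf_neq0 //; apply: fixed => //;
  rewrite rmorphM dE ?pE ?sE.
Qed.

(** [averaging] is applied to f/m and g/m, which is possible since m is invertible in characteristic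
    zero. *)
Lemma qdelta_y_decomposition (D : {ratxy K} -> {ratxy K}) f g :
  [pchar K] =i pred0 -> zmod_morphism D ->
  (forall u, D (rat_qshift_y q u) = rat_qshift_y q (D u)) ->
  D f = rat_qdelta_y q g ->
  exists h a b, [/\ rat_qshift_y q a = a, rat_qshift_y q b = b, D a = 0,
    f = rat_qdelta_y q h + a & g = D h + b].
Proof.
move=> char0 DB Dt Dfg.
have tB := extension_zmod_morphism ty_neq0 rat_qshift_y_tofrac.
pose t : {additive {ratxy K} -> {ratxy K}} := HB.pack (rat_qshift_y q)
  (GRing.isZmodMorphism.Build _ _ (rat_qshift_y q) tB).
pose D' : {additive {ratxy K} -> {ratxy K}} := HB.pack D
  (GRing.isZmodMorphism.Build _ _ D DB).
have m0 : m%:R != 0 :> {ratxy K}.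
  rewrite -(rmorph_nat (@rat_const K)) fmorph_eq0.
  by move/pcharf0P: char0 => ->; rewrite -lt0n.
have divm (u : {ratxy K}) : (u / m%:R) *+ m = u by rewrite -[LHS]mulr_natr divfK.
(* [D] is only assumed additive, so the equation is checked after multiplication by m. *)
have Dfg' : D' (f / m%:R) = t (g / m%:R) - g / m%:R.
  have Df : D' (f / m%:R) *+ m = D f by rewrite -raddfMn divm.
  have tg : t (g / m%:R) *+ m = t g by rewrite -raddfMn divm.
  apply: (mulIf m0); rewrite [LHS]mulr_natr Df [RHS]mulr_natr mulrnBl tg divm.
  exact: Dfg.
have [h [a [b [ta tb Da fE gE]]]] :=
  @averaging _ t D' m _ _ Dt (extension_iter ty_neq0 rat_qshift_y_tofrac iter_ty) Dfg'.
by exists h, a, b; rewrite !divm in fE gE.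
Qed.

End QShift.

(** * Rational constants of the derivation and of the shift in x *)

Lemma rat_shift_x_tofrac (K : fieldType) (p s : {poly {poly K}}) : s != 0 ->
  rat_shift_x (p%:F / s%:F) =
  (subst_xy ('X + 1) 'X p)%:F / (subst_xy ('X + 1) 'X s)%:F.
Proof.
move=> s0; rewrite rat_shift_x_frac //.
have -> : rat_x + 1 = ('X + 1)%:F :> {ratxy K} by rewrite rmorphD rmorph1.
by rewrite !(eval_xy_tofrac _ 'X).
Qed.

Lemma subst_shift_neq0 (K : fieldType) (s : {poly {poly K}}) : s != 0 ->
  subst_xy ('X + 1) 'X s != 0.
Proof. by rewrite subst_Xy comp_poly2_eq0 // size_XaddC. Qed.

Lemma rat_constant_frac (K : fieldType) (p s : {poly {poly K}}) c e :
  s != 0 -> e != 0 -> p * e%:P = c%:P * s ->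
  p%:F / s%:F = c%:P%:F / e%:P%:F.
Proof.
move=> s0 e0 E; apply/eqP; rewrite eqr_div ?tofrac_eq0 ?polyC_eq0 //.
by rewrite -!rmorphM E.
Qed.

Lemma rat_deriv_x_eq0 (K : fieldType) (f : {ratxy K}) :
  [pchar K] =i pred0 -> rat_deriv_x f = 0 ->
  exists c e : {poly K}, e != 0 /\ f = c%:P%:F / e%:P%:F.
Proof.
move=> char0; have [s s0 [p ->]] := rat_frac f; rewrite rat_deriv_x_frac //.
move=> /eqP; rewrite mulf_eq0 invr_eq0 !tofrac_eq0 expf_eq0 (negPf s0) orbF.
rewrite subr_eq0 => /eqP ps.
have [|||c [e [e0 E]]] := @constant_descent _ (@deriv {poly K}) _ _ _ p s s0 ps.
- by move=> r; apply: lt_size_deriv.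
- by move=> r; apply: deriv_eq0_size => i; rewrite pchar_poly char0.
(* Differentiating the proportion yields the common term [u^]() * r^[()] on both sides, which
   cancels. *)
- move=> u r r0 /(congr1 (@deriv _)); rewrite !derivM addrC.
  by move=> /addrI.
by exists c, e; split=> //; apply: rat_constant_frac E.
Qed.

Lemma rat_delta_x_eq0 (K : fieldType) (f : {ratxy K}) :
  [pchar K] =i pred0 -> rat_delta_x f = 0 ->
  exists c e : {poly K}, e != 0 /\ f = c%:P%:F / e%:P%:F.
Proof.
move=> char0; have [s s0 [p ->]] := rat_frac f => /eqP; rewrite subr_eq0 => /eqP.
have charP : [pchar {poly K}] =i pred0 by move=> i; rewrite pchar_poly char0.
move=> /(extension_fix (@subst_shift_neq0 K) (@rat_shift_x_tofrac K) s0) E.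
have {E} ps : (p \Po ('X + 1)) * s = p * (s \Po ('X + 1)).
  by rewrite -!subst_Xy; apply: E.
pose D : {additive {poly {poly K}} -> {poly {poly K}}} :=
  comp_poly ('X + 1) \- idfun.
have DE r : D r = r \Po ('X + 1) - r by [].
(* The product [u * r] occurs on both sides, so proportionality for the difference and for the shift
   are equivalent. *)
have Dps u r : (D u * r == u * D r) = ((u \Po ('X + 1)) * r == u * (r \Po ('X + 1))).
  by rewrite !DE mulrBl mulrBr (inj_eq (addIr _)).
have [||||c [e [e0 E]]] := @constant_descent _ D _ _ _ p s s0.
- by move=> r; apply: size_comp_shiftB.
- by move=> r /eqP; rewrite subr_eq0 => /eqP; apply: comp_shift_eq_size.
- move=> u r r0 E.
  have /eqP := E; rewrite Dps => /eqP E1.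
  have r10 : r \Po ('X + 1) != 0 by rewrite comp_poly2_eq0 // size_XaddC.
  (* Shifting the proportion and comparing with [E1] allows the shifted factor of [r] to be
     cancelled. *)
  have := congr1 (comp_poly ('X + 1)) E; rewrite !comp_polyM => E2.
  suff E3 : (D u \Po ('X + 1)) * r = u * (D r \Po ('X + 1)).
    by rewrite (DE (D u)) (DE (D r)) mulrBl mulrBr E3 E.
  by apply: (mulIf r10); rewrite mulrAC E2 mulrAC E1 mulrAC.
- by apply/eqP; rewrite Dps ps.
by exists c, e; split=> //; apply: rat_constant_frac E.
Qed.

(** * Assembly for the three operators in x *)

Theorem theorem1 (K : closedFieldType) (char0 : [pchar K] =i pred0)
    (q : K) (q_neq0 : q != 0) (m : nat) (q_order : m.-primitive_root q)
    (d : x_operator) (f g : {ratxy K}) :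
  x_apply q d f = rat_qdelta_y q g ->
  exists h a b : {ratxy K},
    [/\ in_subfield2 rat_x (rat_y ^+ m) a,
        in_subfield2 rat_x (rat_y ^+ m) b,
        x_apply q d a = 0,
        f = rat_qdelta_y q h + a /\ g = x_apply q d h + b
      & match d with
        | Op_D | Op_Delta => in_subfield1 (rat_y ^+ m) a
        | Op_qDelta => in_subfield2 (rat_x ^+ m) (rat_y ^+ m) a
        end].
Proof.
have ty0 := ty_neq0 q_order; have tx0 := tx_neq0 q_order.
have tyE := rat_qshift_y_tofrac q_order.
have txE := rat_qshift_x_tofrac q_order.
have yB := extension_zmod_morphism ty0 tyE.
have delta_zmod (S : {ratxy K} -> {ratxy K}) : zmod_morphism S ->
    zmod_morphism (fun u => S u - u).
  by move=> SB u v; rewrite /= SB !opprD !opprK addrACA.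
have delta_comm (S : {ratxy K} -> {ratxy K}) :
    (forall u, S (rat_qshift_y q u) = rat_qshift_y q (S u)) ->
    forall u, S (rat_qshift_y q u) - rat_qshift_y q u = rat_qshift_y q (S u - u).
  by move=> SC u; rewrite yB SC.
(* The decomposition asks two things of the x-operator: additivity, and commutation with the q-shift
   in y ([DC]). *)
have DB : zmod_morphism (x_apply q d).
  case: d => /=; first exact: rat_deriv_x_zmod_morphism.
    apply: delta_zmod.
    exact: extension_zmod_morphism (@subst_shift_neq0 K) (@rat_shift_x_tofrac K).
  exact/delta_zmod/(extension_zmod_morphism tx0 txE).
have DC u : x_apply q d (rat_qshift_y q u) = rat_qshift_y q (x_apply q d u).
  case: d {DB} => /=; first exact: (rat_deriv_x_comm ty0 tyE).
    apply: delta_comm => {}u.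
    apply: (extension_comm ty0 (@subst_shift_neq0 K) tyE (@rat_shift_x_tofrac K)).
    by move=> r; apply: subst_xy_comm; rewrite rmorphD rmorph1 /= map_polyX.
  apply: delta_comm => {}u.
  exact: (extension_comm ty0 tx0 tyE txE (@ty_tx _ q)).
move=> /(qdelta_y_decomposition q_order char0 DB DC).
move=> [h [a [b [ta tb Da fE gE]]]]; exists h, a, b.
split=> //; try exact: (qshift_y_fix q_order).
case: d Da {DB DC fE gE} => /= Da.
(* A constant [a] is a quotient of polynomials in y alone, so its invariance can be exploited inside
   K[y]. *)
- have [c [e [e0 aE]]] := rat_deriv_x_eq0 char0 Da.
  by rewrite aE in ta *; apply: (qshift_y_fix_y q_order e0 ta).
- have [c [e [e0 aE]]] := rat_delta_x_eq0 char0 Da.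
  by rewrite aE in ta *; apply: (qshift_y_fix_y q_order e0 ta).
(* Here [x_apply q d a = 0] says that [a] is fixed by the q-shift in x as well. *)
- by apply: (qshift_xy_fix q_order _ ta); apply/eqP; rewrite -subr_eq0; apply/eqP.
Qed.
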